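(* Let $\mathcal{H}$ be a separable complex Hilbert space. The sequence induced by each controlled g-frame is a controlled frame: if $C\in GL(\mathcal{H})$ and $\{\Lambda_i\}_{i\in J}$, $\Lambda_i\in\mathcal{L}(\mathcal{H},\mathcal{H}_i)$, is a $C$-controlled g-frame for $\mathcal{H}$, and $\{e_{i,k}:k\in K_i\}$ is an orthonormal basis of $\mathcal{H}_i$ for each $i\in J$, then the induced sequence $\{\psi_{i,k}=\Lambda_i^{\star}e_{i,k}:i\in J,k\in K_i\}$ is a frame for $\mathcal{H}$ controlled by $C$.
   Context: $J\subseteq\mathbb{Z}$ and $K_i\subseteq\mathbb{Z}$ are index sets, $\{\mathcal{H}_i\}_{i\in J}$ is a sequence of separable complex Hilbert spaces, $\mathcal{L}(\mathcal{H},\mathcal{H}_i)$ is the set of bounded linear operators $\mathcal{H}\to\mathcal{H}_i$, and $GL(\mathcal{H})$ is the set of bounded linear operators on $\mathcal{H}$ with bounded inverse. A $C$-controlled g-frame is a family $\{\Lambda_i\}_{i\in J}$, $\Lambda_i\in\mathcal{L}(\mathcal{H},\mathcal{H}_i)$, for which there exist constants $m_{CL}>0$ and $M_{CL}<\infty$ with $m_{CL}\|f\|^2\le\sum_{i\in J}\langle\Lambda_iC^{\star}f,\Lambda_if\rangle\le M_{CL}\|f\|^2$ for all $f\in\mathcal{H}$. A frame controlled by $C$ is a countable family of vectors $(\psi_n)$ in $\mathcal{H}$ for which there exist constants $m_{CL}>0$ and $M_{CL}<\infty$ with $m_{CL}\|f\|^2\le\sum_n\langle f,\psi_n\rangle\langle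 C\psi_n,f\rangle\le M_{CL}\|f\|^2$ for all $f\in\mathcal{H}$. (In both cases the sum is required to converge to a real number.) *)

(* Defs.v *)
From HB Require Import structures.
From mathcomp Require Import all_boot all_order all_algebra.
From mathcomp Require Import finmap complex sesquilinear.
From mathcomp Require Import boolp classical_sets functions cardinality.
From mathcomp Require Import reals topology normedtype.
From mathcomp Require Import summability.

Set Implicit Arguments.
Unset Strict Implicit.
Unset Printing Implicit Defensive.

Import Order.TTheory GRing.Theory Num.Theory.
Import numFieldNormedType.Exports.

Local Open Scope classical_set_scope.
Local Open Scope ring_scope.
Local Open Scope complex_scope.

(* The topology and norm that R[i] has as a numFieldType are not inferred from
   the head symbol complex; this makes them available on R[i] itself. *)
HB.instance Definition _ (R : realType) := NormedModule.copy R[i] R[i]^o.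

(* The norm of a normed module over R[i] takes its values in R[i]. The inner
   product is linear in its first argument and conjugate-linear in the second. *)
HB.mixin Record CompleteNormedModule_isHilbert (R : realType) H
    & CompleteNormedModule R[i] H := {
  inner : {dot H for Num.conj};
  sqr_norm_inner : forall x : H, `|x| ^+ 2 = inner x x
}.

#[short(type="hilbertType")]
HB.structure Definition Hilbert (R : realType) :=
  {H of CompleteNormedModule R[i] H & CompleteNormedModule_isHilbert R H}.

Definition separable_space (T : topologicalType) :=
  exists S : set T, countable S /\ dense S.

Section Operators.
Variables (R : realType) (H G : hilbertType R).

Definition bounded_op (A : H -> G) :=
  exists M : R, forall x, `|A x| <= M%:C * `|x|.

(* When A is linear and bounded, the set below is a singleton (by the Riesz
   representation theorem); the default value 0 is only used for other A. *)
Definition adjoint (A : H -> G) (y : G) : H :=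
  xget 0 [set z | forall x, inner (A x) y = inner x z].

End Operators.

Definition in_GL (R : realType) (H : hilbertType R) (C : {linear H -> H}) :=
  bounded_op C /\
  exists D : {linear H -> H}, [/\ bounded_op D, cancel C D & cancel D C].

(* Unordered summation: the net of the sums over the finite subsets of the
   index type converges to s. *)
Definition has_sum (R : realType) (I : choiceType) (x : I -> R[i]) (s : R[i]) :=
  partial_sum x @ totally --> s.

Definition orthonormal_basis (R : realType) (H : hilbertType R)
    (I : choiceType) (e : I -> H) :=
  (forall k l, inner (e k) (e l) = (k == l)%:R) /\
  dense [set x | exists (c : I -> R[i]) (A : {fset I}),
                   x = partial_sum (fun k => c k *: e k) A].

Definition controlled_gframe (R : realType) (H : hilbertType R) (J : set int)
    (G : J -> hilbertType R) (C : H -> H) (Lambda : forall i, H -> G i) :=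
  exists m M : R, 0 < m /\
    forall f : H, exists s : R,
      [/\ has_sum (fun i : J => inner (Lambda i (adjoint C f)) (Lambda i f)) s%:C,
          m%:C * `|f| ^+ 2 <= s%:C & s%:C <= M%:C * `|f| ^+ 2].

Definition controlled_frame (R : realType) (H : hilbertType R)
    (I : countType) (C : H -> H) (psi : I -> H) :=
  exists m M : R, 0 < m /\
    forall f : H, exists s : R,
      [/\ has_sum (fun n => inner f (psi n) * inner (C (psi n)) f) s%:C,
          m%:C * `|f| ^+ 2 <= s%:C & s%:C <= M%:C * `|f| ^+ 2].

Definition induced_seq (R : realType) (H : hilbertType R) (J : set int)
    (G : J -> hilbertType R) (K : J -> set int)
    (Lambda : forall i, H -> G i) (e : forall i : J, K i -> G i)
    (p : {i : J & K i}) : H :=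
  adjoint (Lambda (tag p)) (e (tag p) (tagged p)).

(* Main.v *)
(* Let C' be the adjoint of C. A priori the terms <Lambda_i C' f, Lambda_i f>
   are only summable over i, which says nothing about summability over the
   pairs (i, k). Invertibility of C repairs this: by polarization the terms
   <Lambda_i C' h, Lambda_i g> are summable for all h and g, and the choice
   C' h = g shows that q(g) = sum_i |Lambda_i g|^2 converges. By Parseval in
   each G_i and nonnegativity, q(g) = sum_(i,k) |<Lambda_i g, e_(i,k)>|^2 as
   well. Polarizing both expansions of q at (f, C' f) identifies the frame
   series with the (conjugated) g-frame series. The adjoints exist by the Riesz
   representation theorem, proved by minimizing |x|^2 - 2 Re phi(x). *)
Require Import Defs.
From HB Require Import structures.
From mathcomp Require Import all_boot all_order all_algebra.
From mathcomp Require Import finmap complex sesquilinear.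
From mathcomp Require Import boolp classical_sets functions cardinality.
From mathcomp Require Import reals topology normedtype.
From mathcomp Require Import summability ring.

Set Implicit Arguments.
Unset Strict Implicit.
Unset Printing Implicit Defensive.

Import Order.TTheory GRing.Theory Num.Theory.
Import numFieldNormedType.Exports.

Local Open Scope classical_set_scope.
Local Open Scope ring_scope.

(** * Unordered sums in a numeric field, which may be only partially ordered *)

Section UnorderedSums.
Variable K : numFieldType.

Let half_gt0 (x : K) : 0 < x -> 0 < x / 2.
Proof. by move=> x0; rewrite divr_gt0. Qed.

(** An elementary form of [has_sum] that avoids filters; [has_sumP] shows that the two agree on
    [R[i]]. *)
Definition sums_to (I : choiceType) (u : I -> K) (s : K) :=
  forall eps : K, 0 < eps -> exists A0 : {fset I}, forall A : {fset I},
    (A0 `<=` A)%fset -> `|\sum_(i <- A) u i - s| < eps.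

Lemma eq_sums_to (I : choiceType) (u v : I -> K) (s : K) :
  u =1 v -> sums_to u s -> sums_to v s.
Proof. by move=> /funext ->. Qed.

Lemma sums_toD (I : choiceType) (u v : I -> K) (s t : K) :
  sums_to u s -> sums_to v t -> sums_to (fun i => u i + v i) (s + t).
Proof.
move=> us vt eps eps0.
have [A hA] := us _ (half_gt0 eps0).
have [B hB] := vt _ (half_gt0 eps0).
exists (A `|` B)%fset => D; rewrite fsubUset => /andP[/hA uD /hB vD].
rewrite big_split /= opprD addrACA [eps]splitr.
by rewrite (le_lt_trans (ler_normD _ _)) // ltrD.
Qed.

Lemma sums_toZ (I : choiceType) (u : I -> K) (s a : K) :
  sums_to u s -> sums_to (fun i => a * u i) (a * s).
Proof.
move=> us eps eps0; have a1 : 0 < `|a| + 1 by rewrite ltr_wpDl.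
have [A hA] := us _ (divr_gt0 eps0 a1).
exists A => B /hA; rewrite ltr_pdivlMr // => uB.
rewrite -mulr_sumr -mulrBr normrM mulrC; apply: le_lt_trans uB.
by rewrite ler_wpM2l // lerDl.
Qed.

Lemma sums_to_unique (I : choiceType) (u : I -> K) (s t : K) :
  sums_to u s -> sums_to u t -> s = t.
Proof.
move=> us ut; apply/eqP; rewrite -subr_eq0 -normr_eq0; apply/contraT => st0.
have {}st0 : 0 < `|s - t| by rewrite lt_def st0 normr_ge0.
have [A hA] := us _ (half_gt0 st0).
have [B hB] := ut _ (half_gt0 st0).
have := ltrD (hA _ (fsubsetUl A B)) (hB _ (fsubsetUr A B)).
rewrite -splitr distrC => /(le_lt_trans (ler_normD _ _)).
by rewrite addrA subrK ltxx.
Qed.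

Lemma ler_sum_fsubset (I : choiceType) (u : I -> K) (A B : {fset I}) :
  (forall i, 0 <= u i) -> (A `<=` B)%fset ->
  \sum_(i <- A) u i <= \sum_(i <- B) u i.
Proof.
move=> u0 AB; rewrite [leRHS](big_fsetID _ (mem A)) /=.
rewrite (_ : [fset x in B | x \in A]%fset = A) ?lerDl ?sumr_ge0 //.
by apply/fsetP => x; rewrite !inE /= andb_idl // => /(fsubsetP AB).
Qed.

Lemma sums_to_ge0P (I : choiceType) (u : I -> K) (s : K) :
  (forall i, 0 <= u i) ->
  sums_to u s <->
  (forall A : {fset I}, \sum_(i <- A) u i <= s) /\
  (forall eps : K, 0 < eps -> exists A : {fset I}, s - eps < \sum_(i <- A) u i).
Proof.
move=> u0; split=> [us|[us sup] eps eps0]; last first.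
  have [A hA] := sup _ eps0; exists A => B AB.
  rewrite distrC ger0_norm ?subr_ge0 // ltrBlDr addrC -ltrBlDr.
  exact: lt_le_trans (ler_sum_fsubset u0 AB).
have ub (A : {fset I}) : \sum_(i <- A) u i <= s.
  rewrite -subr_ge0; set d := _ - _.
  (* [s] is not known to be real, so [d] cannot be assumed comparable with 0. It is shown to equal
     its norm instead, because the nonnegative numbers [p] come arbitrarily close to it. *)
  suff /eqP -> : d == `|d| by [].
  rewrite -subr_eq0 -normr_eq0; apply/contraT => d0.
  have {}d0 : 0 < `|d - `|d| | by rewrite lt_def d0 normr_ge0.
  have [B hB] := us _ (half_gt0 d0).
  pose p := \sum_(i <- (A `|` B)%fset) u i - \sum_(i <- A) u i.
  have p0 : 0 <= p by rewrite subr_ge0 ler_sum_fsubset // fsubsetUl.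
  have dp : `|p - d| < `|d - `|d| | / 2.
    by rewrite /p /d opprB addrA subrK hB // fsubsetUr.
  have : `|d - `|d| | <= `|d - p| + `|p - d|.
    rewrite (le_trans (ler_distD p _ _)) // lerD2l.
    by rewrite -{1}(ger0_norm p0) ler_dist_dist.
  rewrite [X in _ <= X + _]distrC => /le_lt_trans/(_ (ltrD dp dp)).
  by rewrite -splitr ltxx.
split=> // eps eps0; have [A hA] := us _ eps0; exists A.
have := hA _ (fsubset_refl A); rewrite distrC ger0_norm ?subr_ge0 //.
by rewrite ltrBlDr addrC -ltrBlDr.
Qed.

(** By nonnegativity, only suprema of finite sums matter. Every finite set of pairs lies in some
    [S T B], over which the sum is iterated; this gives the upper bound. For the lower bound, half
    of [eps] is spent on the choice of [T] and half is shared among its fibres. *)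
Lemma sums_to_sigma (I : choiceType) (J : I -> choiceType)
    (u : {i : I & J i} -> K) (v : I -> K) (w : K) :
  (forall p, 0 <= u p) ->
  (forall i, sums_to (fun j : J i => u (Tagged J j)) (v i)) ->
  sums_to v w -> sums_to u w.
Proof.
move=> u0 uv vw.
have u0' i (j : J i) : 0 <= u (Tagged J j) by [].
have hu i := (sums_to_ge0P (v i) (u0' i)).1 (uv i).
have v0 i : 0 <= v i by have := (hu i).1 fset0; rewrite big_seq_fset0.
have [wub wsup] := (sums_to_ge0P w v0).1 vw.
pose S (T : {fset I}) (B : forall i, {fset J i}) :=
  [fset (Tagged J j) | i in T, j in B i]%fset.
have sumS T B : \sum_(p <- S T B) u p =
    \sum_(i <- T) \sum_(j <- B i) u (Tagged J j).
  by rewrite big_imfset2 //= => -[i j] [i' j'] _ _ /=.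
apply/(sums_to_ge0P w u0); split=> [A|eps eps0].
  pose T := [fset tag p | p in A]%fset.
  pose tagi i (j : J i) : {i : I & J i} := Tagged J j.
  pose B i := fset_set (tagi i @^-1` [set` A]).
  have AS : (A `<=` S T B)%fset.
    apply/fsubsetP => -[i j] pA; apply/imfset2P; exists i => /=.
      by apply/imfsetP; exists (existT _ i j).
    exists j => //=; rewrite in_fset_set ?inE //.
    apply: finite_preimage; last exact: finite_fset.
    by move=> x y _ _ /eqP; rewrite eq_Tagged => /eqP.
  rewrite (le_trans (ler_sum_fsubset u0 AS)) // sumS (le_trans _ (wub T)) //.
  by apply: ler_sum => i _; apply: (hu i).1.
have [T hT] := wsup _ (half_gt0 eps0).
(* The successor keeps the denominator nonzero when [T] is empty. *)
pose d := eps / 2 / (#|` T|.+1)%:R.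
have d0 : 0 < d by rewrite divr_gt0 ?half_gt0.
pose B i := projT1 (cid ((hu i).2 _ d0)).
have hB i : v i - d < \sum_(j <- B i) u (Tagged J j).
  by rewrite /B; case: cid.
exists (S T B); rewrite sumS.
have : \sum_(i <- T) (v i - d) <= \sum_(i <- T) \sum_(j <- B i) u (Tagged J j).
  by apply: ler_sum => i _; apply: ltW.
apply: lt_le_trans; rewrite big_split /= sumrN big_const_seq count_predT.
rewrite iter_addr_0 -mulr_natr [eps]splitr opprD addrA ltr_leD // lerN2.
rewrite /d mulrAC ler_pdivrMr // ler_wpM2l ?ler_nat ?leqnSn //.
by rewrite ltW ?half_gt0.
Qed.

End UnorderedSums.

Lemma sums_to_conj (K : numClosedFieldType) (I : choiceType) (u : I -> K)
    (s : K) :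
  sums_to u s -> sums_to (fun i => (u i)^*) s^*.
Proof.
move=> us eps /us[A hA]; exists A => B /hA.
by rewrite -rmorph_sum -rmorphB /= norm_conjC.
Qed.

(** * Polarization of sesquilinear forms *)

Section Polarization.
Variables (K : numClosedFieldType) (V : lmodType K).

Definition sesquilinear (B : V -> V -> K) :=
  bilinear_for *%R (Num.conj \; *%R) B.

Definition polar (q : V -> K) (x y : V) : K :=
  (q (x + y) - q (x - y) + 'i * q (x + 'i *: y) - 'i * q (x - 'i *: y)) / 4.

Lemma polarE (B : V -> V -> K) (x y : V) :
  sesquilinear B -> B x y = polar (fun z => B z z) x y.
Proof.
move=> [Bl Br].
have Dl a u v w : B (u + a *: v) w = B u w + a * B v w.
  by rewrite addrC Bl addrC.
have Dr a u v w : B w (u + a *: v) = B w u + a^* * B w v.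
  by rewrite addrC Br addrC.
(* The four points in [polar] are x + a y with a = 1, -1, i, -i. *)
have BD a : B (x + a *: y) (x + a *: y) =
    B x x + a^* * B x y + a * B y x + a * a^* * B y y.
  rewrite Dl !Dr; ring.
rewrite /polar -[in x - 'i *: y]scaleNr -[in x - y]scaleN1r.
rewrite -[in x + y](scale1r y) !BD !rmorphN /= conjCi conjC1.
have i2 : 'i * 'i = -1 :> K by rewrite -expr2 sqrCi.
by field: i2.
Qed.

(** [polar] is a finite linear combination of diagonal values, so convergence on the diagonal passes
    to every pair. The four-term identity also covers forms that are not hermitian, such as
    <Lambda_i C' x, Lambda_i y>. *)
Lemma sums_to_polar (I : choiceType) (B : I -> V -> V -> K) (q : V -> K)
    (x y : V) :
  (forall i, sesquilinear (B i)) ->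
  (forall z, sums_to (fun i => B i z z) (q z)) ->
  sums_to (fun i => B i x y) (polar q x y).
Proof.
move=> Bs Bq.
have h : sums_to (fun i => polar (fun z => B i z z) x y) (polar q x y).
  rewrite /polar mulrC; under eq_fun do rewrite mulrC.
  apply: sums_toZ; rewrite -mulNr; under eq_fun do rewrite -mulNr.
  apply: sums_toD; last exact: sums_toZ.
  apply: sums_toD; last exact: sums_toZ.
  apply: sums_toD => //; rewrite -mulN1r; under eq_fun do rewrite -mulN1r.
  exact: sums_toZ.
by apply: eq_sums_to h => i; rewrite -polarE.
Qed.

End Polarization.

(** * Cauchy-Schwarz inequality and Parseval identity *)

Section Orthonormal.
Variables (K : numClosedFieldType) (V : lmodType K) (f : {dot V for Num.conj}).
Local Notation "''[' u , v ]" := (f u%R v%R) : ring_scope.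
Local Notation "''[' u ]" := '[u, u] : ring_scope.

Lemma dot_conj x y : '[y, x] = '[x, y]^*.
Proof. by rewrite hermC expr0 mul1r. Qed.

Lemma dot_cauchy_schwarz x y : `|'[x, y]| ^+ 2 <= '[x] * '[y].
Proof.
have [->|y0] := eqVneq y 0; first by rewrite !linear0r normr0 mulr0 expr0n.
have y0' : 0 < '[y] by rewrite dnorm_gt0.
rewrite -(ler_pM2l y0') -subr_ge0.
suff -> : '[y] * ('[x] * '[y]) - '[y] * `|'[x, y]| ^+ 2 =
  '['[y] *: x - '[x, y] *: y] by [].
rewrite dnormB !dnormZ linearZl_LR linearZr_LR /= normCK.
rewrite (ger0_norm (ltW y0')) !rmorphM /= conjCK (geC0_conj (ltW y0')).
ring.
Qed.

Variables (I : choiceType) (e : I -> V).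
Hypothesis e_orthonormal : forall k l, '[e k, e l] = (k == l)%:R.

(** Completing the square. Taking c_k = <x, e_k> removes the last sum and gives Bessel's inequality;
    for any other [c] that sum is nonnegative, so a good approximation of [x] forces the Bessel sum
    close to |x|^2. *)
Lemma dnorm_sub_comb (A : {fset I}) (c : I -> K) (x : V) :
  '[x - \sum_(k <- A) c k *: e k] =
  '[x] - \sum_(k <- A) `|'[x, e k]| ^+ 2
       + \sum_(k <- A) `|c k - '[x, e k]| ^+ 2.
Proof.
set y := \sum_(k <- A) _.
have xy : '[x, y] = \sum_(k <- A) (c k)^* * '[x, e k].
  by rewrite linear_sumr; apply: eq_bigr => k _; rewrite linearZr_LR.
have yy : '[y] = \sum_(k <- A) `|c k| ^+ 2.
  rewrite {1}/y linear_sumlz; apply: eq_fbigr => k kA _.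
  rewrite linearZl_LR linear_sumr (big_fsetD1 k) //= big1_fset ?addr0.
    by rewrite linearZr_LR /= e_orthonormal eqxx mulr1 normCK.
  move=> l; rewrite !inE => /andP[lk _] _.
  by rewrite linearZr_LR /= e_orthonormal eq_sym (negbTE lk) mulr0.
have -> : \sum_(k <- A) `|c k - '[x, e k]| ^+ 2 =
    \sum_(k <- A) `|c k| ^+ 2 - ('[x, y] + '[x, y]^*)
      + \sum_(k <- A) `|'[x, e k]| ^+ 2.
  rewrite xy rmorph_sum -big_split /= -sumrB -big_split /=.
  apply: eq_bigr => k _; rewrite !normCK rmorphB rmorphM /= conjCK; ring.
by rewrite dnormB yy; ring.
Qed.

Lemma sums_to_parseval (x : V) :
  (forall y (eps : K), 0 < eps -> exists (c : I -> K) (A : {fset I}),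
     '[y - \sum_(k <- A) c k *: e k] < eps) ->
  sums_to (fun k => `|'[x, e k]| ^+ 2) '[x].
Proof.
move=> e_dense; apply/sums_to_ge0P; first by move=> k; rewrite exprn_ge0.
split=> [A|eps /(e_dense x)[c [A hA]]].
  have := dnorm_sub_comb A (fun k => '[x, e k]) x.
  rewrite [X in _ = _ + X]big1 ?addr0.
    by rewrite -subr_ge0 => <-.
  by move=> k _; rewrite subrr normr0 expr0n.
exists A; rewrite ltrBlDr addrC -ltrBlDr; apply: le_lt_trans hA.
by rewrite dnorm_sub_comb lerDl sumr_ge0 // => k _; rewrite exprn_ge0.
Qed.

End Orthonormal.

(** In the order of [R[i]], a common lower bound forces all values to have the same imaginary part,
    so the infimum can be taken on real parts. *)
Lemma exists_infimum (R : realType) (T : Type) (J : T -> R[i]) (x0 : T)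
    (m : R[i]) :
  (forall x, m <= J x) ->
  exists d : R[i], (forall x, d <= J x) /\
    forall eps : R[i], 0 < eps -> exists x, J x < d + eps.
Proof.
move=> mJ.
pose X := [set complex.Re (J x) | x in setT].
have X0 : X !=set0 by exists (complex.Re (J x0)), x0.
have Xm : lbound X (complex.Re m).
  by move=> _ [x _ <-]; have := mJ x; rewrite lecE => /andP[].
have ImJ x : complex.Im (J x) = complex.Im m.
  by apply/eqP; have := mJ x; rewrite lecE => /andP[].
exists (inf X +i* complex.Im m)%C; split=> [x|eps].
  rewrite lecE ImJ eqxx /=; apply: ge_inf; first by exists (complex.Re m).
  by exists x.
rewrite ltcE /= => /andP[/eqP eps0i eps0].
have [|_ [x _ <-] hx] := @inf_adherent _ X _ eps0.
  by split=> //; exists (complex.Re m).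
exists x; rewrite ltcE ImJ; case: eps eps0i {eps0} hx => a b /= -> ->.
by rewrite addr0 eqxx.
Qed.

(** * Riesz representation theorem *)

Section Riesz.
Variables (R : realType) (H : hilbertType R) (phi : H -> R[i]) (M : R[i]).
Hypothesis phi_scalar : scalar phi.
Hypothesis M_gt0 : 0 < M.
Hypothesis phi_bounded : forall x, `|phi x| ^+ 2 <= M * inner x x.

(** If phi = <., z>, then J x = |x - z|^2 - |z|^2, so the representing vector is the minimizer of
    [J]. *)
Let J (x : H) : R[i] := inner x x - (phi x + (phi x)^*).

Let phiD x y : phi (x + y) = phi x + phi y.
Proof. by have := phi_scalar 1 x y; rewrite scale1r mul1r. Qed.

Let phiZ a x : phi (a *: x) = a * phi x.
Proof.
have := phi_scalar a x 0; have := phi_scalar 1 0 0.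
rewrite scale1r mul1r addr0 => /eqP; rewrite -subr_eq0 opprD addrA subrr add0r.
by rewrite oppr_eq0 => /eqP ->; rewrite !addr0.
Qed.

Let J_ge (x : H) : - M <= J x.
Proof.
rewrite -subr_ge0 opprK -(pmulr_rge0 _ M_gt0) /J.
have -> : M * (inner x x - (phi x + (phi x)^*) + M) =
    M * inner x x - `|phi x| ^+ 2 + `|phi x - M| ^+ 2.
  rewrite !normCK rmorphB /= (geC0_conj (ltW M_gt0)); ring.
by rewrite addr_ge0 ?exprn_ge0 // subr_ge0.
Qed.

(* Parallelogram identity: near-minimizers of J are close to each other. *)
Let J_mid (x y : H) :
  inner (x - y) (x - y) = 2 * J x + 2 * J y - 4 * J (2^-1 *: (x + y)).
Proof.
rewrite /J phiZ phiD linearZl_LR linearZr_LR /= dnormB dnormD.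
rewrite rmorphM rmorphD /= (geC0_conj (_ : 0 <= 2^-1)) ?invr_ge0 //.
by field.
Qed.

Let J_shift (x y : H) a :
  J (y + a *: x) = J y + (a * (inner x y - phi x) + (a * (inner x y - phi x))^*)
    + `|a| ^+ 2 * inner x x.
Proof.
rewrite /J phiD phiZ dnormD dnormZ linearZr_LR /= (dot_conj inner x y).
rewrite !(rmorphM, rmorphD, rmorphB) /= !conjCK; ring.
Qed.

(* Evaluate J at the minimizer of J along the complex line y + a x, up to
   replacing |x|^2 by 1 + |x|^2, which avoids dividing by 0 when x = 0. *)
Let near_min (x y : H) (d eps : R[i]) :
  (forall z, d <= J z) -> J y < d + eps ->
  `|inner x y - phi x| ^+ 2 <= eps * (1 + inner x x).
Proof.
move=> dJ Jy; set w := inner x y - phi x.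
pose c : R[i] := 1 + inner x x.
have c0 : 0 < c by rewrite ltr_pwDl // dnorm_ge0.
have a_conj : (c^-1 * w^*)^* = c^-1 * w.
  by rewrite rmorphM /= conjCK (geC0_conj (_ : 0 <= c^-1)) // invr_ge0 ltW.
have := dJ (y + (- (c^-1 * w^*)) *: x).
rewrite J_shift -/w normrN normCK a_conj !mulNr rmorphN /= rmorphM /= a_conj.
have -> : J y + (- (c^-1 * w^* * w) - c^-1 * w * w^*)
    + c^-1 * w^* * (c^-1 * w) * inner x x =
    J y - c^-1 * `|w| ^+ 2 - c^-1 ^+ 2 * `|w| ^+ 2.
  rewrite normCK /c; field; exact: lt0r_neq0.
move=> dle; have : c^-1 * `|w| ^+ 2 <= eps.
  rewrite -(lerD2l d) (le_trans _ (ltW Jy)) // -lerBrDr (le_trans dle) //.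
  by rewrite gerBl mulr_ge0 // exprn_ge0 // invr_ge0 ltW.
by rewrite mulrC ler_pdivrMr.
Qed.

Lemma riesz : exists z : H, forall x, phi x = inner x z.
Proof.
have [d [dJ Jd]] := exists_infimum 0 J_ge.
(* The sublevel sets of [J] just above its infimum generate a filter, and its limit is the
   representing vector. *)
pose F : set_system H := filter_from [set eps : R | 0 < eps]
  (fun eps => [set x | J x < d + (eps%:C)%C]).
have FF : ProperFilter F.
  apply: filter_from_proper; last first.
    by move=> eps /= eps0; apply: Jd; rewrite ltcR.
  apply: filter_from_filter; first by exists 1 => /=.
  move=> a b a0 b0; exists (Num.min a b); first by rewrite /= lt_min a0.
  move=> x /= Jx; split; apply: lt_le_trans Jx _;
    by rewrite lerD2l lecR ge_min lexx ?orbT.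
have F_of (eps : R[i]) : 0 < eps -> F [set x | J x < d + eps].
  move=> eps0; exists (complex.Re eps) => /=.
    by move: eps0; rewrite ltcE => /andP[].
  by rewrite RRe_real // gtr0_real.
have cF : cauchy F.
  apply: cauchy_exP => e e0.
  (* By [J_mid], two points with J < d + e^2/4 whose midpoint has J >= d are at squared distance
     less than e^2. *)
  have e4 : 0 < e ^+ 2 / 4 by rewrite divr_gt0 // exprn_gt0.
  have [x Jx] := Jd _ e4; exists x.
  apply: filterS (F_of _ e4) => y Jy; rewrite -ball_normE /ball_ /=.
  rewrite -(@ltr_pXn2r _ 2) ?nnegrE ?(ltW e0) // sqr_norm_inner J_mid.
  have := dJ (2^-1 *: (x + y)); rewrite -(ler_pM2l (_ : 0 < 4)) //.
  move=> Jm; rewrite ltrBlDr; apply: (@lt_le_trans _ _ (e ^+ 2 + 4 * d)).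
    have -> : e ^+ 2 + 4 * d = 2 * (d + e ^+ 2 / 4) + 2 * (d + e ^+ 2 / 4).
      by field.
    by apply: ltrD; rewrite ltr_pM2l.
  by rewrite lerD2l.
have Fz := (fcvgrPdist_lt (lim F)).1 (cauchy_cvg F cF); set z := lim F in Fz.
exists z => x; apply/eqP; rewrite -subr_eq0 -normr_eq0; apply/contraT => D0.
set D := phi x - inner x z in D0 *.
have {}D0 : 0 < `|D| ^+ 2 by rewrite exprn_gt0 // lt_def D0 normr_ge0.
pose c : R[i] := 1 + inner x x.
have c0 : 0 < c by rewrite ltr_pwDl // dnorm_ge0.
(* Continuity of [J] is bypassed: a near-minimizer [y] close to [z] gives |D|^2 <= 4 eta c, and the
   factor 8 makes the right side |D|^2 / 2, a contradiction. *)
pose eta := `|D| ^+ 2 / (8 * c).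
have eta0 : 0 < eta by rewrite divr_gt0 // mulr_gt0.
have e0 : 0 < sqrtC eta by rewrite sqrtC_gt0.
have [y [zy Jy]] := filter_ex (filterI (Fz _ _ _ e0) (F_of _ eta0)).
have h1 := near_min x dJ Jy.
have h2 := dot_cauchy_schwarz inner x (z - y).
have h3 : inner (z - y) (z - y) <= eta.
  rewrite -sqr_norm_inner -[eta]sqrtCK ltW //.
  by rewrite ltr_pXn2r ?nnegrE ?(ltW e0).
have : `|D| ^+ 2 <= 2 * (eta * c) + 2 * (eta * c).
  apply: le_trans (_ : 2 * `|inner x y - phi x| ^+ 2
                       + 2 * `|inner x (z - y)| ^+ 2 <= _).
    rewrite -subr_ge0 (_ : _ - _ =
      `|inner x y - phi x - inner x (z - y)| ^+ 2) ?exprn_ge0 //.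
    rewrite /D linearBr !normCK !rmorphB /=; ring.
  apply: lerD; rewrite ler_pM2l //; apply: le_trans h2 _.
  by rewrite mulrC ler_pM ?dnorm_ge0 // lerDr.
have -> : 2 * (eta * c) + 2 * (eta * c) = `|D| ^+ 2 / 2.
  rewrite /eta; field; exact: lt0r_neq0.
rewrite ler_pdivlMr // mulr_natr mulr2n gerDl => /(lt_le_trans D0).
by rewrite ltxx.
Qed.
End Riesz.

Lemma has_sumP (R : realType) (I : choiceType) (u : I -> R[i]) (s : R[i]) :
  has_sum u s <-> sums_to u s.
Proof.
have FF : Filter (@totally I) by exact: (@filter_filter _ _ totally_filter).
split=> [/cvgrPdistC_lt us eps eps0|us].
  have [A _ hA] := us _ eps0.
  by exists A => B /hA; rewrite big_seq_fsetE.
apply/cvgrPdistC_lt => eps /us[A hA]; exists A => //= B /hA.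
by rewrite big_seq_fsetE.
Qed.

(** * Adjoints of bounded operators, and approximation by an orthonormal basis *)

Section Adjoint.
Variables (R : realType).

Lemma inner_injr (H : hilbertType R) (y z : H) :
  (forall x, inner x y = inner x z) -> y = z.
Proof.
move=> yz; apply/eqP; rewrite -subr_eq0 -(dnorm_eq0 inner) linearBr subr_eq0.
by apply/eqP; exact: yz.
Qed.

Lemma adjointP (H G : hilbertType R) (A : {linear H -> G}) :
  bounded_op A -> forall x y, inner (A x) y = inner x (adjoint A y).
Proof.
move=> [M hM] x y.
suff [z hz] : exists z, forall x, inner (A x) y = inner x z.
  by rewrite /adjoint; case: xgetP => [w _ ->//|/(_ z)].
have M2 : 0 <= (M%:C)%C ^+ 2 by rewrite -rmorphXn /= ler0c sqr_ge0.
(* Cauchy-Schwarz bounds the functional by M^2 |y|^2; the added 1 makes the constant positive even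
   when this vanishes. *)
apply: (@riesz _ _ _ ((M%:C)%C ^+ 2 * inner y y + 1)).
- by move=> a u v; rewrite linearP linearPl.
- by rewrite ltr_wpDl // mulr_ge0 // dnorm_ge0.
move=> u; apply: le_trans (dot_cauchy_schwarz inner _ _) _.
rewrite -(sqr_norm_inner (A u)) mulrDl mul1r ler_wpDr ?dnorm_ge0 //.
rewrite [X in _ <= X]mulrAC ler_wpM2r ?dnorm_ge0 // -sqr_norm_inner -exprMn.
have := hM u; set a := (_ * _) => ha.
by rewrite ler_pXn2r ?nnegrE // (le_trans _ ha).
Qed.

Lemma adjoint_linear (H G : hilbertType R) (A : {linear H -> G}) :
  bounded_op A -> linear (adjoint A).
Proof.
move=> bA a y z; apply: inner_injr => x.
by rewrite -(adjointP bA) !linearPr /= -!(adjointP bA).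
Qed.

Lemma adjoint_cancel (H G : hilbertType R) (A : {linear H -> G})
    (D : {linear G -> H}) :
  bounded_op A -> bounded_op D -> cancel A D -> cancel (adjoint D) (adjoint A).
Proof.
move=> bA bD AD y; apply: inner_injr => x.
by rewrite -(adjointP bA) -(adjointP bD) AD.
Qed.

Lemma orthonormal_basis_approx (H : hilbertType R) (I : choiceType)
    (e : I -> H) (y : H) (eps : R[i]) :
  orthonormal_basis e -> 0 < eps -> exists (c : I -> R[i]) (A : {fset I}),
    inner (y - \sum_(k <- A) c k *: e k) (y - \sum_(k <- A) c k *: e k) < eps.
Proof.
move=> [_ e_dense] eps0; have s0 : 0 < sqrtC eps by rewrite sqrtC_gt0.
have [|z [/interior_subset + [c [A zE]]]] :=
    e_dense (ball y (sqrtC eps))° _ (open_interior _).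
  by exists y; apply: nbhsx_ballx.
have -> : z = \sum_(k <- A) c k *: e k by rewrite zE big_seq_fsetE.
rewrite -ball_normE /ball_ /= => yx; exists c, A.
rewrite -sqr_norm_inner -[eps]sqrtCK.
by rewrite ltr_pXn2r ?nnegrE ?(ltW s0).
Qed.

End Adjoint.

Theorem proposition4p2 (R : realType) (H : hilbertType R)
    (J : set int) (G : J -> hilbertType R) (K : J -> set int)
    (C : {linear H -> H}) (Lambda : forall i : J, {linear H -> G i})
    (e : forall i : J, K i -> G i) :
  separable_space H ->
  (forall i, separable_space (G i)) ->
  in_GL C ->
  (forall i, bounded_op (Lambda i)) ->
  controlled_gframe C Lambda ->
  (forall i, orthonormal_basis (e i)) ->
  controlled_frame C (induced_seq Lambda e).
Proof.
move=> _ _ [bC [D [bD CD _]]] bL [m [M [m0 gf]]] onb.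
(* The frame series will have the same sum [s f] as the g-frame series, so the bounds carry over
   unchanged. *)
exists m, M; split=> // f.
have [s hs] := choice gf.
have /choice[q hq] : forall g : H, exists t : R[i],
    sums_to (fun i => inner (Lambda i g) (Lambda i g)) t.
  move=> g.
  have B_sesq i : sesquilinear
      (fun x y => inner (Lambda i (adjoint C x)) (Lambda i y)).
    split=> [y a x z|x a y z] /=; last by rewrite linearP linearPr.
    by rewrite (adjoint_linear bC) linearP linearPl.
  have B_sum z : sums_to
      (fun i => inner (Lambda i (adjoint C z)) (Lambda i z)) (s z)%:C%C.
    by apply/has_sumP; case: (hs z).
  (* [adjoint D g] is the vector h with C' h = g. *)
  have := sums_to_polar (adjoint D g) g B_sesq B_sum.
  rewrite (adjoint_cancel bC bD CD) => hg; eexists; exact: hg.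
have hpsi (x : H) (p : {i : J & K i}) :
    inner x (induced_seq Lambda e p) =
    inner (Lambda (tag p) x) (e (tag p) (tagged p)).
  by rewrite -(adjointP (bL _)).
have hs_f : polar q f (adjoint C f) = (s f)%:C%C.
  have [hf _ _] := hs f.
  (* Swapping the arguments of the inner product conjugates the g-frame series; its sum is real,
     hence unchanged. *)
  rewrite -[RHS]conj_Creal; last by apply/complex_realP; exists (s f).
  apply: (@sums_to_unique _ J
    (fun i => inner (Lambda i f) (Lambda i (adjoint C f)))).
    apply: (@sums_to_polar _ _ _
      (fun i x y => inner (Lambda i x) (Lambda i y))) => // i.
    by split=> [y a x z|x a y z] /=; rewrite linearP ?linearPr ?linearPl.
  apply: eq_sums_to (sums_to_conj ((has_sumP _ _).1 hf)) => i.
  by rewrite -(dot_conj inner).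
exists (s f); have [_ ? ?] := hs f; split=> //.
apply/has_sumP; rewrite -hs_f.
(* At (f, C' f) this form is the frame term, as <C psi, f> = <psi, C' f>. On the diagonal it is |<g,
   psi>|^2, whose nonnegativity permits summing over pairs. *)
pose B (p : {i : J & K i}) (x y : H) :=
  inner x (induced_seq Lambda e p) * inner (induced_seq Lambda e p) y.
apply: (@eq_sums_to _ _ (fun p => B p f (adjoint C f))) => [p|].
  by rewrite /B -(adjointP bC).
apply: sums_to_polar => [p|g].
  split=> [y a x z|x a y z] /=; rewrite /B.
    by rewrite linearPl mulrDl mulrA.
  by rewrite linearPr /= mulrDr mulrCA.
apply: (sums_to_sigma (v := fun i => inner (Lambda i g) (Lambda i g))) => //.
  by move=> p; rewrite /B (dot_conj inner g) -normCK exprn_ge0.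
move=> i.
apply: (@eq_sums_to _ _ (fun k => `|inner (Lambda i g) (e i k)| ^+ 2)) => [k|].
  by rewrite /B (dot_conj inner g) hpsi normCK.
apply: sums_to_parseval; first by case: (onb i).
by move=> y eps; apply: orthonormal_basis_approx.
Qed.
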